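(* Let $n\ge3$, $m\ge2$. For every $1\le j\le m-1$, $$R_j^\epsilon\circ\phi_\epsilon=\phi_\epsilon\circ R_{M_j}^\epsilon$$ as maps $\mathcal{Y}'_\epsilon\to\mathcal{Q}_\epsilon$; that is, the quantum geometric $R$-matrix $R_j^\epsilon$ and the quantum cluster $R$-matrix $R_{M_j}^\epsilon$ are compatible via the embedding $\phi_\epsilon$.
   Context: Second indices are taken in $\mathbb{Z}/n\mathbb{Z}$, and $\epsilon$ is a central indeterminate. Quantum geometric side. For $k\in\mathbb{Z}/n\mathbb{Z}$ let $S_k$ be the set of $q_{j,i}$ with $i+j\equiv1+k\pmod n$. $\mathcal{Q}_\epsilon$ is the skew field of fractions of the quantum torus over $\mathbb{Z}[\epsilon,\epsilon^{-1}]$ generated by the $q_{j,i}^{\pm1}$ ($1\le j\le m$, $i\in\mathbb{Z}/n\mathbb{Z}$) with relations $$q_{j,i}q_{j',i'}=\begin{cases}\epsilon\,q_{j',i'}q_{j,i}&q_{j,i}\in S_{k+1},\ q_{j',i'}\in S_k,\ j\le j',\\ \epsilon^{-1}q_{j',i'}q_{j,i}&q_{j,i}\in S_{k+1},\ q_{j',i'}\in S_k,\ j>j',\\ \epsilon^{-2}q_{j',i'}q_{j,i}&q_{j,i},q_{j',i'}\in S_k,\ j<j',\\ \epsilon^{2}q_{j',i'}q_{j,i}&q_{j,i},q_{j',i'}\in S_k,\ j>j',\\ q_{j',i'}q_{j,i}&\text{if neither } (q_{j,i},q_{j',i'}) \text{ nor } (q_{j',i'},q_{j,i}) \text{ is covered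 by the previous cases.}\end{cases}$$ For $1\le j\le m-1$ write $p_i=q_{j,i}$, $q_i=q_{j+1,i}$, and $\kappa_i^\epsilon=\sum_{h=0}^{n-1}p_{i-1}p_{i-2}\cdots p_{i-h}\,q_{i-h-2}q_{i-h-3}\cdots q_{i-n}$ (factors in this order). $R_j^\epsilon:\mathcal{Q}_\epsilon\to\mathcal{Q}_\epsilon$ is the morphism of skew fields with $R_j^\epsilon(p_i)=(\kappa_i^\epsilon)^{-1}q_i\,\kappa_{i+1}^\epsilon$, $R_j^\epsilon(q_i)=(\kappa_{i+1}^\epsilon)^{-1}p_i\,\kappa_i^\epsilon$, fixing $\epsilon$ and all $q_{j',i}$ with $j'\ne j,j+1$. Quantum cluster side. $\mathcal{Y}_\epsilon$ is the skew field of fractions of the quantum torus over $\mathbb{Z}[\epsilon,\epsilon^{-1}]$ generated by $y_{j,i}^{\pm1}$ ($0\le j\le m$, $i\in\mathbb{Z}/n\mathbb{Z}$) with relations $y_{j,i}y_{j+1,i}=\epsilon^2y_{j+1,i}y_{j,i}$ and $y_{j,i}y_{j+1,i-1}=\epsilon^{-2}y_{j+1,i-1}y_{j,i}$ for $0\le j\le m-1$, $y_{j,i}y_{j,i+1}=\epsilon^{-2}y_{j,i+1}y_{j,i}$ for $0\le j\le m$, all other pairs commuting. For $1\le j\le m-1$ put $\alpha_i^\epsilon=1+\sum_{k=1}^{n-1}\epsilon^k\,y_{j,i}y_{j,i+1}\cdots y_{j,i+k-1}$; $R_{M_j}^\epsilon:\mathcal{Y}_\epsilon\to\mathcal{Y}_\epsilon$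 is the morphism of skew fields fixing $\epsilon$ with $$R_{M_j}^\epsilon(y_{j,i})=(\alpha_{i+2}^\epsilon)^{-1}y_{j,i+1}^{-1}\alpha_i^\epsilon,\quad R_{M_j}^\epsilon(y_{j-1,i})=(\alpha_i^\epsilon)^{-1}\epsilon\,y_{j,i}y_{j-1,i}\,\alpha_{i+1}^\epsilon,\quad R_{M_j}^\epsilon(y_{j+1,i})=(\alpha_{i+1}^\epsilon)^{-1}\epsilon\,y_{j,i+1}y_{j+1,i}\,\alpha_{i+2}^\epsilon,$$ fixing $y_{j',i}$ for $j'\notin\{j-1,j,j+1\}$. $\mathcal{Y}'_\epsilon\subset\mathcal{Y}_\epsilon$ is the skew subfield generated by the $y_{j,i}$ with $1\le j\le m-1$; it is preserved by all $R_{M_j}^\epsilon$, $1\le j\le m-1$. Embedding. $\phi_\epsilon:\mathcal{Y}'_\epsilon\to\mathcal{Q}_\epsilon$ is the embedding of skew fields, fixing $\epsilon$, with $\phi_\epsilon(y_{j,i})=\epsilon^{-1}q_{j,i}^{-1}q_{j+1,i-1}$ for $1\le j\le m-1$, $i\in\mathbb{Z}/n\mathbb{Z}$. *)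

(* Defs.v *)
From HB Require Import structures.
From mathcomp Require Import all_boot all_order all_algebra ring finmap.
From mathcomp.multinomials Require Import monalg.
From mathcomp Require Import boolp.

Set Implicit Arguments.
Unset Strict Implicit.
Unset Printing Implicit Defensive.

Import GRing.Theory Num.Theory.
Local Open Scope ring_scope.

(* Quantum tori.  For om : I -> I -> int, [qtorus om] is the Z-algebra with   *)
(* basis eps^e * X^v, for e : int and v : {ffun I -> int}, where X^v is the   *)
(* product of the X_a^(v a) in increasing order of a, multiplied according to *)
(* X_a X_b = eps^(om a b) X_b X_a.  Only the values om a b with a after b     *)
(* enter the product, so the relation holds for all pairs exactly when om is  *)
(* antisymmetric (qtorusX_comm below).                                        *)
Section QuantumTorus.
Variables (I : finType) (om : I -> I -> int).

Definition qmonom : Type := (int * {ffun I -> int})%type.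
HB.instance Definition _ := Choice.on qmonom.

(* X^v * X^w = eps^(qcocycle v w) X^(v + w) *)
Definition qcocycle (v w : {ffun I -> int}) : int :=
  \sum_a \sum_(b | (enum_rank b < enum_rank a)%N) v a * w b * om a b.

Definition qmonom1 : qmonom := (0, 0).
Definition qmonom_mul (k l : qmonom) : qmonom :=
  (k.1 + l.1 + qcocycle k.2 l.2, k.2 + l.2).

Lemma qcocycleDl v1 v2 w :
  qcocycle (v1 + v2) w = qcocycle v1 w + qcocycle v2 w.
Proof.
rewrite /qcocycle -big_split; apply: eq_bigr => a _ /=.
by rewrite -big_split; apply: eq_bigr => b _ /=; rewrite ffunE !mulrDl.
Qed.

Lemma qcocycleDr v w1 w2 :
  qcocycle v (w1 + w2) = qcocycle v w1 + qcocycle v w2.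
Proof.
rewrite /qcocycle -big_split; apply: eq_bigr => a _ /=.
rewrite -big_split; apply: eq_bigr => b _ /=.
by rewrite ffunE mulrDr mulrDl.
Qed.

Lemma qcocycle0l w : qcocycle 0 w = 0.
Proof. by apply: (addIr (qcocycle 0 w)); rewrite -qcocycleDl !add0r. Qed.

Lemma qcocycle0r v : qcocycle v 0 = 0.
Proof. by apply: (addIr (qcocycle v 0)); rewrite -qcocycleDr !add0r. Qed.

Lemma qmonom_mulA : associative qmonom_mul.
Proof.
move=> k l p; rewrite /qmonom_mul /= qcocycleDl qcocycleDr.
by congr pair; [ring | exact: addrA].
Qed.

Lemma qmonom_mul1m : left_id qmonom1 qmonom_mul.
Proof. by case=> e v; rewrite /qmonom_mul /= qcocycle0l addr0 !add0r. Qed.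

Lemma qmonom_mulm1 : right_id qmonom1 qmonom_mul.
Proof. by case=> e v; rewrite /qmonom_mul /= qcocycle0r !addr0. Qed.

(* The argument keeps apart the ring structures attached to different om.     *)
Definition qtorus of (I -> I -> int) : Type := {malg int[qmonom]}.
Local Notation T := (qtorus om).
HB.instance Definition _ := GRing.Zmodule.on T.

Local Notation U c k := (@mkmalgU qmonom int k c).

(* The proofs below follow those of the ring structure on {malg R[K]}, which  *)
(* does not apply here because monomTypes have no nontrivial units.           *)
Definition qtorus1 : T := U 1 qmonom1.
Definition qtorus_mul (g1 g2 : T) : T :=
  \sum_(k1 <- msupp g1) \sum_(k2 <- msupp g2)
     U (mcoeff k1 g1 * mcoeff k2 g2) (qmonom_mul k1 k2).

Lemma qtorus_mulw (d1 d2 : {fset qmonom}) (g1 g2 : T) :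
  (msupp g1 `<=` d1)%fset -> (msupp g2 `<=` d2)%fset ->
  qtorus_mul g1 g2 = \sum_(k1 <- d1) \sum_(k2 <- d2)
     U (mcoeff k1 g1 * mcoeff k2 g2) (qmonom_mul k1 k2).
Proof.
move=> le_d1 le_d2; rewrite /qtorus_mul (big_fset_incl _ le_d1) /=.
  apply/eq_bigr=> k1 _; apply/big_fset_incl => // k _ /mcoeff_outdom ->.
  by rewrite mulr0 monalgU0.
move=> k _ /mcoeff_outdom g1k.
by rewrite big1 => // k' _; rewrite g1k mul0r monalgU0.
Qed.

Lemma qtorus_mulDl : left_distributive qtorus_mul +%R.
Proof.
move=> g1 g2 g; rewrite [in RHS](qtorus_mulw (fsubsetUl _ (msupp g2))
  (fsubset_refl _)).
rewrite [in RHS](qtorus_mulw (fsubsetUr (msupp g1) _) (fsubset_refl _)).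
rewrite (qtorus_mulw (msuppD_le _ _) (fsubset_refl _)).
rewrite -big_split /=; apply/eq_bigr=> k1 _.
rewrite -big_split /=; apply/eq_bigr=> k2 _.
by rewrite mcoeffD mulrDl monalgUD.
Qed.

Lemma qtorus_mulDr : right_distributive qtorus_mul +%R.
Proof.
move=> g g1 g2; rewrite [in RHS](qtorus_mulw (fsubset_refl _)
  (fsubsetUl _ (msupp g2))).
rewrite [in RHS](qtorus_mulw (fsubset_refl _) (fsubsetUr (msupp g1) _)).
rewrite (qtorus_mulw (fsubset_refl _) (msuppD_le _ _)).
rewrite -big_split /=; apply/eq_bigr=> k1 _.
rewrite -big_split /=; apply/eq_bigr=> k2 _.
by rewrite mcoeffD mulrDr monalgUD.
Qed.

Lemma qtorus_mul0g : left_zero 0 qtorus_mul.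
Proof. by move=> g; rewrite /qtorus_mul msupp0 big_seq_fset0. Qed.

Lemma qtorus_mulg0 : right_zero 0 qtorus_mul.
Proof.
by move=> g; rewrite /qtorus_mul msupp0 big1 // => k _; rewrite big_seq_fset0.
Qed.

Lemma qtorus_mulUU c1 c2 k1 k2 :
  qtorus_mul (U c1 k1) (U c2 k2) = U (c1 * c2) (qmonom_mul k1 k2).
Proof. by rewrite (qtorus_mulw msuppU_le msuppU_le) !big_seq_fset1 !mcoeffUU. Qed.

Lemma qtorus_mulEl (g1 g2 : T) :
  qtorus_mul g1 g2 = \sum_(k <- msupp g1) qtorus_mul (U (mcoeff k g1) k) g2.
Proof.
apply/eq_bigr=> k _; rewrite (qtorus_mulw msuppU_le (fsubset_refl _)).
by rewrite big_seq_fset1; apply/eq_bigr => l _; rewrite mcoeffUU.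
Qed.

Lemma qtorus_mulEr (g1 g2 : T) :
  qtorus_mul g1 g2 = \sum_(k <- msupp g2) qtorus_mul g1 (U (mcoeff k g2) k).
Proof.
rewrite {1}/qtorus_mul exchange_big /=.
apply/eq_bigr=> k _; rewrite (qtorus_mulw (fsubset_refl _) msuppU_le).
by apply/eq_bigr => l _; rewrite big_seq_fset1 mcoeffUU.
Qed.

Lemma qtorus_mulA : associative qtorus_mul.
Proof.
move=> g1 g2 g3.
rewrite [RHS](big_morph (qtorus_mul^~ _) (fun _ _ => qtorus_mulDl _ _ _)
  (qtorus_mul0g _)).
rewrite qtorus_mulEl; apply/eq_bigr=> k1 _.
rewrite [LHS](big_morph (qtorus_mul _) (fun _ _ => qtorus_mulDr _ _ _)
  (qtorus_mulg0 _)).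
rewrite [RHS](big_morph (qtorus_mul^~ _) (fun _ _ => qtorus_mulDl _ _ _)
  (qtorus_mul0g _)).
apply/eq_bigr=> k2 _.
rewrite [LHS](big_morph (qtorus_mul _) (fun _ _ => qtorus_mulDr _ _ _)
  (qtorus_mulg0 _)).
rewrite qtorus_mulEr; apply/eq_bigr=> k3 _.
by rewrite !qtorus_mulUU mulrA qmonom_mulA.
Qed.

Lemma qtorus_mul1g : left_id qtorus1 qtorus_mul.
Proof.
move=> g; rewrite qtorus_mulEr [RHS]monalgE; apply/eq_bigr => k _.
by rewrite qtorus_mulUU mul1r qmonom_mul1m.
Qed.

Lemma qtorus_mulg1 : right_id qtorus1 qtorus_mul.
Proof.
move=> g; rewrite qtorus_mulEl [RHS]monalgE; apply/eq_bigr => k _.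
by rewrite qtorus_mulUU mulr1 qmonom_mulm1.
Qed.

Lemma qtorus1_neq0 : qtorus1 != 0.
Proof. by rewrite monalgU_eq0. Qed.

HB.instance Definition _ := GRing.Zmodule_isNzRing.Build T
  qtorus_mulA qtorus_mul1g qtorus_mulg1 qtorus_mulDl qtorus_mulDr qtorus1_neq0.

Definition qdelta (c : int) (a : I) : {ffun I -> int} :=
  [ffun b => if b == a then c else 0].

Definition qtorus_epsZ (e : int) : T := U 1 (e, 0).
Definition qtorus_eps : T := qtorus_epsZ 1.
Definition qtorusX (a : I) : T := U 1 (0, qdelta 1 a).
Definition qtorusXV (a : I) : T := U 1 (0, qdelta (-1) a).

Lemma qtorus_epsZ0 : qtorus_epsZ 0 = 1.
Proof. by []. Qed.

Lemma qtorus_epsZD e f : qtorus_epsZ (e + f) = qtorus_epsZ e * qtorus_epsZ f.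
Proof.
by rewrite [RHS]qtorus_mulUU /qmonom_mul /= qcocycle0l !addr0 mulr1.
Qed.

Lemma qtorus_eps_central (g : T) : qtorus_eps * g = g * qtorus_eps.
Proof.
rewrite [LHS]qtorus_mulEr [RHS]qtorus_mulEl; apply/eq_bigr => k _.
rewrite !qtorus_mulUU /qmonom_mul /= qcocycle0l qcocycle0r !addr0 add0r.
by rewrite mulr1 mul1r [1 + _]addrC.
Qed.

Lemma qcocycle_delta (c d : int) (a b : I) :
  qcocycle (qdelta c a) (qdelta d b)
    = if (enum_rank b < enum_rank a)%N then c * d * om a b else 0.
Proof.
rewrite /qcocycle (bigD1 a) //= [X in _ + X]big1 ?addr0; last first.
  move=> x /negbTE xa; rewrite big1 // => y _.
  by rewrite ffunE xa !mul0r.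
case: ifPn => lt_ba; last first.
  rewrite big1 // => y lt_ya; rewrite !ffunE.
  case: (eqVneq y b) => [yb|_]; last by rewrite mulr0 mul0r.
  by rewrite -yb lt_ya in lt_ba.
rewrite (bigD1 b) //= big1 ?addr0 => [|y /andP[_ /negbTE yb]].
  by rewrite !ffunE !eqxx.
by rewrite !ffunE yb !mulr0 mul0r.
Qed.

Lemma qtorusXK a : qtorusX a * qtorusXV a = 1 /\ qtorusXV a * qtorusX a = 1.
Proof.
split; rewrite [LHS]qtorus_mulUU /qmonom_mul /= qcocycle_delta ltnn mulr1;
  rewrite !add0r; congr (U _ (_, _)); apply/ffunP => b; rewrite !ffunE;
  by case: eqP; rewrite ?addr0 ?subrr ?addNr.
Qed.

Lemma qtorusX_comm a b : om a b = - om b a ->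
  qtorusX a * qtorusX b = qtorus_epsZ (om a b) * (qtorusX b * qtorusX a).
Proof.
move=> om_anti.
rewrite [qtorusX a * _]qtorus_mulUU [qtorusX b * _]qtorus_mulUU.
rewrite [RHS]qtorus_mulUU /qmonom_mul /= !qcocycle_delta qcocycle0l.
rewrite !mulr1 !mul1r !add0r addr0 [qdelta 1 b + _]addrC.
congr (U _ (_, _)); case: ltngtP => [_|_|/val_inj/enum_rank_inj eq_ba].
- by rewrite addr0.
- by rewrite om_anti addNr.
- move: om_anti; rewrite addr0 eq_ba => /eqP.
  by rewrite -addr_eq0 -mulr2n mulrn_eq0 => /eqP ->.
Qed.

End QuantumTorus.

(* A skew field of fractions of T: a division ring containing T in which      *)
(* every element is a fraction x / y with x, y in T.  It is unique up to a    *)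
(* unique isomorphism over T.                                                 *)
Record skewFracField (T : nzRingType) := SkewFracField {
  sff_sort :> unitRingType;
  sff_inj : {rmorphism T -> sff_sort};
  sff_unit : forall x : sff_sort, x != 0 -> x \is a GRing.unit;
  sff_injective : injective sff_inj;
  sff_frac : forall x : sff_sort,
    exists a b : T, b != 0 /\ x = sff_inj a / sff_inj b
}.
Arguments sff_inj {T s}.

Lemma sff_injX_comm (I : finType) (om : I -> I -> int)
    (F : skewFracField (qtorus om)) (a b : I) : om a b = - om b a ->
  sff_inj (qtorusX om a) * sff_inj (qtorusX om b) =
  sff_inj (qtorus_epsZ om (om a b))
    * (sff_inj (qtorusX om b) * sff_inj (qtorusX om a)) :> F.
Proof.
move=> om_anti; rewrite -(rmorphM sff_inj (qtorusX om a)) qtorusX_comm //.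
by rewrite (rmorphM sff_inj (qtorus_epsZ om _)) (rmorphM sff_inj (qtorusX om b)).
Qed.

(* The skew subfield generated by S. In a division ring, divring_closed       *)
(* (1, x - y and x / y) characterizes skew subfields, as x / 0 = 0.           *)
Section SkewSubfield.
Variables (D : unitRingType) (S : D -> Prop).

Definition skew_gen : {pred D} := [pred x | `[< forall P : {pred D},
  divring_closed P -> (forall y, S y -> y \in P) -> x \in P >]].

Lemma skew_genP x : reflect (forall P : {pred D},
  divring_closed P -> (forall y, S y -> y \in P) -> x \in P) (x \in skew_gen).
Proof. exact: asboolP. Qed.

Lemma skew_gen_closed : divring_closed skew_gen.
Proof.
split=> [|x y /skew_genP Sx /skew_genP Sy|x y /skew_genP Sx /skew_genP Sy];
  apply/skew_genP => P Pc SP.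
- by case: Pc.
- by case: (Pc) => _ + _; apply; [apply: Sx | apply: Sy].
- by case: (Pc) => _ _; apply; [apply: Sx | apply: Sy].
Qed.

Lemma mem_skew_gen x : S x -> x \in skew_gen.
Proof. by move=> Sx; apply/skew_genP => P _; apply. Qed.

HB.instance Definition _ := GRing.isDivringClosed.Build D skew_gen
  skew_gen_closed.

Lemma skew_genV x : x \in skew_gen -> x^-1 \in skew_gen.
Proof. by rewrite rpredV. Qed.

Lemma skew_genM x y :
  x \in skew_gen -> y \in skew_gen -> x * y \in skew_gen.
Proof. by move=> Sx Sy; apply: rpredM. Qed.

Record skewSubfield := SkewSubfield
  { skewsub_val :> D; _ : skewsub_val \in skew_gen }.
HB.instance Definition _ := [isSub for skewsub_val].
HB.instance Definition _ := [Choice of skewSubfield by <:].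
HB.instance Definition _ := [SubChoice_isSubUnitRing of skewSubfield by <:].

Lemma skewsubP (x : skewSubfield) : val x \in skew_gen.
Proof. exact: valP. Qed.

Definition skewsub_restrict (f : D -> D)
    (fS : forall x, x \in skew_gen -> f x \in skew_gen)
    (x : skewSubfield) : skewSubfield :=
  SkewSubfield (fS (val x) (skewsubP x)).

End SkewSubfield.

(* Index pairs (j, i) carry the row j : nat with its value in the paper's     *)
(* range (1 <= j <= m, resp. 0 <= j <= m); columns are in 'Z_n, n >= 3.       *)
Section Geometric.
Variables (m n : nat).

(* q_(j,i) is in S_k if and only if i + j = 1 + k, i.e. k = geom_class (j,i). *)
Definition geom_class (a : nat * 'Z_n) : 'Z_n := a.2 + a.1%:R - 1.

(* q_a q_b = eps^(geom_form a b) q_b q_a *)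
Definition geom_form (a b : nat * 'Z_n) : int :=
  if geom_class a == geom_class b + 1 then (if (a.1 <= b.1)%N then 1 else -1)
  else if geom_class b == geom_class a + 1 then
    (if (b.1 <= a.1)%N then -1 else 1)
  else if geom_class a == geom_class b then
    (if (a.1 < b.1)%N then -2 else if (a.1 > b.1)%N then 2 else 0)
  else 0.

(* The rows are 'I_m, written 'I_m.-1.+1 for inord; the ordinal k stands for  *)
(* the row k.+1.                                                              *)
Definition geom_torus : nzRingType :=
  @qtorus ('I_m.-1.+1 * 'Z_n)%type
    (fun a b => geom_form ((a.1 : nat).+1, a.2) ((b.1 : nat).+1, b.2)).

Variable Q : skewFracField geom_torus.

Definition geom_eps : Q := sff_inj (qtorus_eps _ : geom_torus).

(* meaningful for 1 <= j <= m only *)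
Definition geom_q (j : nat) (i : 'Z_n) : Q :=
  sff_inj (qtorusX _ (inord j.-1, i) : geom_torus).

Definition geom_kappa (j : nat) (i : 'Z_n) : Q :=
  \sum_(0 <= h < n)
     (\prod_(1 <= l < h.+1) geom_q j (i - l%:R)) *
     (\prod_(h.+2 <= l < n.+1) geom_q j.+1 (i - l%:R)).

Record is_geom_R (j : nat) (R : {rmorphism Q -> Q}) : Prop := IsGeomR {
  geom_R_eps : R geom_eps = geom_eps;
  geom_R_p : forall i,
    R (geom_q j i) = (geom_kappa j i)^-1 * geom_q j.+1 i * geom_kappa j (i + 1);
  geom_R_q : forall i,
    R (geom_q j.+1 i) = (geom_kappa j (i + 1))^-1 * geom_q j i * geom_kappa j i;
  geom_R_fix : forall j' i, (1 <= j' <= m)%N -> j' != j -> j' != j.+1 ->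
    R (geom_q j' i) = geom_q j' i
}.

End Geometric.

Section Cluster.
Variables (m n : nat).

(* the exponents of the defining relations, for the ordered pairs listed      *)
Definition cluster_arrow (a b : nat * 'Z_n) : int :=
  2 * ((b.1 == a.1.+1) && (b.2 == a.2))%:Z
  - 2 * ((b.1 == a.1.+1) && (b.2 == a.2 - 1))%:Z
  - 2 * ((b.1 == a.1) && (b.2 == a.2 + 1))%:Z.

(* y_a y_b = eps^(cluster_form a b) y_b y_a *)
Definition cluster_form (a b : nat * 'Z_n) : int :=
  cluster_arrow a b - cluster_arrow b a.

Definition cluster_torus : nzRingType :=
  @qtorus ('I_m.+1 * 'Z_n)%type
    (fun a b => cluster_form (a.1 : nat, a.2) (b.1 : nat, b.2)).

Variable Y : skewFracField cluster_torus.

Definition cluster_eps : Y := sff_inj (qtorus_eps _ : cluster_torus).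

(* meaningful for 0 <= j <= m only *)
Definition cluster_y (j : nat) (i : 'Z_n) : Y :=
  sff_inj (qtorusX _ (inord j, i) : cluster_torus).

Definition cluster_alpha (j : nat) (i : 'Z_n) : Y :=
  1 + \sum_(1 <= k < n)
        cluster_eps ^+ k * \prod_(0 <= l < k) cluster_y j (i + l%:R).

Record is_cluster_R (j : nat) (R : {rmorphism Y -> Y}) : Prop := IsClusterR {
  cluster_R_eps : R cluster_eps = cluster_eps;
  cluster_R_y : forall i,
    R (cluster_y j i) =
    (cluster_alpha j (i + 2))^-1 * (cluster_y j (i + 1))^-1 * cluster_alpha j i;
  cluster_R_yB : forall i,
    R (cluster_y j.-1 i) =
    (cluster_alpha j i)^-1 * cluster_eps * cluster_y j i * cluster_y j.-1 i
      * cluster_alpha j (i + 1);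
  cluster_R_yS : forall i,
    R (cluster_y j.+1 i) =
    (cluster_alpha j (i + 1))^-1 * cluster_eps * cluster_y j (i + 1)
      * cluster_y j.+1 i * cluster_alpha j (i + 2);
  cluster_R_fix : forall j' i, (j' <= m)%N ->
    j' != j.-1 -> j' != j -> j' != j.+1 -> R (cluster_y j' i) = cluster_y j' i
}.

(* The base ring Z[eps, eps^-1] is part of the skew subfield Y'.              *)
Definition cluster_subgens (x : Y) : Prop :=
  x = cluster_eps \/
  exists (j : nat) (i : 'Z_n), (1 <= j <= m.-1)%N /\ x = cluster_y j i.

Definition cluster_sub : unitRingType := skewSubfield cluster_subgens.

Lemma cluster_eps_sub : cluster_eps \in skew_gen cluster_subgens.
Proof. by apply: mem_skew_gen; left. Qed.

Lemma cluster_y_sub j i :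
  (1 <= j <= m.-1)%N -> cluster_y j i \in skew_gen cluster_subgens.
Proof. by move=> hj; apply: mem_skew_gen; right; exists j, i. Qed.

Lemma cluster_alpha_sub j i :
  (1 <= j <= m.-1)%N -> cluster_alpha j i \in skew_gen cluster_subgens.
Proof.
move=> hj; rewrite rpredD ?rpred1 // rpred_sum // => k _.
by rewrite rpredM ?rpredX ?cluster_eps_sub // rpred_prod // => l _;
  apply: cluster_y_sub.
Qed.

Lemma cluster_R_sub j (R : {rmorphism Y -> Y}) :
  (1 <= j <= m.-1)%N -> is_cluster_R j R ->
  forall x, x \in skew_gen cluster_subgens ->
            R x \in skew_gen cluster_subgens.
Proof.
move=> hj [Reps Ry RyB RyS Rfix] x /skew_genP.
pose P : {pred Y} := [pred x | R x \in skew_gen cluster_subgens].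
have PE u : (u \in P) = (R u \in skew_gen cluster_subgens) by [].
move=> /(_ P); rewrite PE; apply.
  split=> [|u v|u v]; rewrite !PE.
  - by rewrite rmorph1 rpred1.
  - by rewrite rmorphB; exact: rpredB.
  - rewrite rmorphM => Ru Rv; apply: rpredM => //.
    have [->|v0] := eqVneq v 0; first by rewrite invr0 rmorph0 rpred0.
    by rewrite rmorphV ?rpredV //; exact: sff_unit.
move=> y; rewrite PE => -[->|[j' [i [hj' ->]]]].
  by rewrite Reps cluster_eps_sub.
have [jj'|j'B] := eqVneq j' j.-1.
  rewrite jj' in hj' *; rewrite RyB.
  apply: skew_genM (cluster_alpha_sub _ hj).
  apply: skew_genM (cluster_y_sub _ hj').
  apply: skew_genM (cluster_y_sub _ hj).
  exact: skew_genM (skew_genV (cluster_alpha_sub _ hj)) cluster_eps_sub.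
have [->|j'0] := eqVneq j' j.
  rewrite Ry; apply: skew_genM (cluster_alpha_sub _ hj).
  exact: skew_genM (skew_genV (cluster_alpha_sub _ hj))
    (skew_genV (cluster_y_sub _ hj)).
have [jj'|j'S] := eqVneq j' j.+1.
  rewrite jj' in hj' *; rewrite RyS.
  apply: skew_genM (cluster_alpha_sub _ hj).
  apply: skew_genM (cluster_y_sub _ hj').
  apply: skew_genM (cluster_y_sub _ hj).
  exact: skew_genM (skew_genV (cluster_alpha_sub _ hj)) cluster_eps_sub.
rewrite Rfix ?cluster_y_sub //.
by case/andP: hj' => _ /leq_trans; apply; exact: leq_pred.
Qed.

Definition cluster_R_restr j (R : {rmorphism Y -> Y})
    (hj : (1 <= j <= m.-1)%N) (hR : is_cluster_R j R) :
    cluster_sub -> cluster_sub :=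
  skewsub_restrict (cluster_R_sub hj hR).

Definition cluster_sub_eps : cluster_sub := SkewSubfield cluster_eps_sub.

Definition cluster_sub_y j i (hj : (1 <= j <= m.-1)%N) : cluster_sub :=
  SkewSubfield (cluster_y_sub i hj).

End Cluster.

(* A ring morphism out of a division ring is automatically injective.         *)
Record is_embedding (m n : nat) (Q : skewFracField (geom_torus m n))
    (Y : skewFracField (cluster_torus m n))
    (phi : {rmorphism cluster_sub Y -> Q}) : Prop := IsEmbedding {
  embedding_eps : phi (cluster_sub_eps Y) = geom_eps Q;
  embedding_y : forall (j : nat) (i : 'Z_n) (hj : (1 <= j <= m.-1)%N),
    phi (cluster_sub_y Y i hj) =
    (geom_eps Q)^-1 * (geom_q Q j i)^-1 * geom_q Q j.+1 (i - 1)
}.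

(* The forms are antisymmetric, so that the defining relations hold. *)
Lemma cluster_formC n (a b : nat * 'Z_n) :
  cluster_form a b = - cluster_form b a.
Proof. exact: (esym (opprB _ _)). Qed.

Lemma geom_formC n (a b : nat * 'Z_n) : (2 < n)%N ->
  geom_form a b = - geom_form b a.
Proof.
move=> n_gt2; rewrite /geom_form.
have two_neq0 : 1 + 1 != 0 :> 'Z_n by case: (n) n_gt2 => [|[|[|]]].
case: (eqVneq (geom_class a) (geom_class b + 1)) => [ab|nab].
  have -> : (geom_class b == geom_class a + 1) = false.
    rewrite ab -addrA -subr_eq0 opprD addrA subrr sub0r oppr_eq0.
    exact: negbTE.
  by case: (a.1 <= b.1)%N.
case: (eqVneq (geom_class b) (geom_class a + 1)) => [ba|nba].
  by case: (b.1 <= a.1)%N; rewrite ?opprK.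
rewrite [geom_class b == _]eq_sym; case: eqP => _; last by rewrite oppr0.
by case: ltngtP; rewrite ?opprK ?oppr0.
Qed.

Lemma geom_q_comm (m n : nat) (Q : skewFracField (geom_torus m n)) j i j' i' :
  (2 < n)%N -> (1 <= j <= m)%N -> (1 <= j' <= m)%N ->
  geom_q Q j i * geom_q Q j' i' =
  sff_inj (qtorus_epsZ _ (geom_form (j, i) (j', i')) : geom_torus m n)
    * (geom_q Q j' i' * geom_q Q j i).
Proof.
move=> n_gt2; case: j => [|j]; case: j' => [|j'] // hj hj'.
have row k : (1 <= k.+1 <= m)%N -> (inord k : 'I_m.-1.+1) = k :> nat.
  by move=> hk; rewrite inordK //; case: (m) hk.
have := @sff_injX_comm _ _ Q (inord j, i) (inord j', i') (geom_formC _ _ n_gt2).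
by rewrite /= !row.
Qed.

Lemma cluster_y_comm (m n : nat) (Y : skewFracField (cluster_torus m n))
    j i j' i' : (j <= m)%N -> (j' <= m)%N ->
  cluster_y Y j i * cluster_y Y j' i' =
  sff_inj (qtorus_epsZ _ (cluster_form (j, i) (j', i')) : cluster_torus m n)
    * (cluster_y Y j' i' * cluster_y Y j i).
Proof.
move=> hj hj'.
have := @sff_injX_comm _ _ Y (inord j, i) (inord j', i') (cluster_formC _ _).
by rewrite /= !inordK.
Qed.

(* Main.v *)
From HB Require Import structures.
Require Import Defs.
From mathcomp Require Import all_boot all_algebra.
From mathcomp Require Import ring zify boolp.

Set Implicit Arguments.
Unset Strict Implicit.
Unset Printing Implicit Defensive.

Import GRing.Theory.
Local Open Scope ring_scope.

(** Both sides are ring morphisms out of the skew field Y', so it suffices to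
compare them on its generators, epsilon and the y_(j',i) (skewsub_eqmorph).
Write p_i = q_(j,i), q_i = q_(j+1,i) and u_i = p_i^-1 q_(i-1), so that
phi(y_(j,i)) = eps^-1 u_i and the powers of epsilon in alpha_i cancel:
phi(alpha_i) = A_i, where A_i is the sum over 0 <= k < n of the products
u_i u_(i+1) ... u_(i+k-1) (phi_alpha).

The heart of the matter is the factorization kappa_i = F p_i^-1 A_(i+1)
(kappaE), where F = p_(i-1) p_(i-2) ... p_(i-n) is the product of a whole row.
Two facts about the commutation exponents give it, and make it useful.

- The exponents of any fixed generator against a whole row add up to zero, so
F commutes with every generator (row_prod_comm). In particular F may be
started at any column, and F disappears from every expression of the form
kappa_i^-1 z kappa_i', where z is a monomial in the generators (kappa_conj).

- A generator has the same exponent against p_i as against q_(i-1), hence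
commutes with u_i, except for some generators of the rows j and j+1 that are
adjacent to u_i (geom_form_ratio, geom_form_ratioS). This relates each term
of kappa_i to the preceding one (kappa_term), and lets generators of the other
rows commute with A_i (ratio_sum_comm).

Conjugation by the kappas thus becomes conjugation by the A's, and each of the
identities for the rows j-1, j, j+1 reduces to moving a few generators past one
another; on all other rows both maps do nothing. *)

(** * Morphisms of skew fields *)

Lemma rmorph_divringV (D E : unitRingType) (f : {rmorphism D -> E}) (x : D) :
  (x != 0 -> x \is a GRing.unit) -> f x^-1 = (f x)^-1.
Proof.
have [->|x0] := eqVneq x 0; first by rewrite invr0 !rmorph0 invr0.
by move=> /(_ isT) xU; rewrite rmorphV.
Qed.

(** Zero factors are allowed, because 0^-1 = 0; so kappa and the sums of ratios
can be inverted formally before they are known to be nonzero. *)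
Lemma divring_invM (D : unitRingType) (x y : D) :
  (forall z : D, z != 0 -> z \is a GRing.unit) -> (x * y)^-1 = y^-1 * x^-1.
Proof.
move=> DU; have [->|x0] := eqVneq x 0; first by rewrite mul0r !invr0 mulr0.
have [->|y0] := eqVneq y 0; first by rewrite mulr0 !invr0 mul0r.
by rewrite invrM ?DU.
Qed.

Lemma unit_mulV_neq0 (D : unitRingType) (x y z : D) :
  x^-1 * y * z \is a GRing.unit -> x != 0.
Proof. by apply: contraTneq => ->; rewrite invr0 !mul0r unitr0. Qed.

Section SubfieldMorphisms.
Variables (D : unitRingType) (S : D -> Prop).

Implicit Types x y z : skewSubfield S.

Lemma skewsub_val_inj x y : skewsub_val x = skewsub_val y -> x = y.
Proof. exact: val_inj. Qed.

(** The inclusion is made a morphism under its own name, so that it can be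
pushed through sums and products without unfolding the generic val. *)
Lemma skewsub_val_zmod_morphism : zmod_morphism (@skewsub_val D S).
Proof. exact: (rmorphB val). Qed.

Lemma skewsub_val_monoid_morphism : monoid_morphism (@skewsub_val D S).
Proof. by split; [apply: (rmorph1 val) | apply: (rmorphM val)]. Qed.

HB.instance Definition _ := GRing.isZmodMorphism.Build _ _
  (@skewsub_val D S) skewsub_val_zmod_morphism.
HB.instance Definition _ := GRing.isMonoidMorphism.Build _ _
  (@skewsub_val D S) skewsub_val_monoid_morphism.

Lemma skewsub_valM x y : skewsub_val (x * y) = skewsub_val x * skewsub_val y.
Proof. exact: rmorphM. Qed.

Section Restriction.
Variables (f : {rmorphism D -> D}).
Hypothesis fS : forall x : D, x \in skew_gen S -> f x \in skew_gen S.

Lemma skewsub_restrict_zmod_morphism : zmod_morphism (skewsub_restrict fS).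
Proof. by move=> x y; apply: skewsub_val_inj; rewrite rmorphB /= -!rmorphB. Qed.

Lemma skewsub_restrict_monoid_morphism : monoid_morphism (skewsub_restrict fS).
Proof.
split=> [|x y]; apply: skewsub_val_inj; last by rewrite rmorphM /= -!rmorphM.
by rewrite [RHS]rmorph1 -(rmorph1 f) -(rmorph1 (@skewsub_val D S)).
Qed.

HB.instance Definition _ := GRing.isZmodMorphism.Build _ _
  (skewsub_restrict fS) skewsub_restrict_zmod_morphism.
HB.instance Definition _ := GRing.isMonoidMorphism.Build _ _
  (skewsub_restrict fS) skewsub_restrict_monoid_morphism.

End Restriction.

Hypothesis DU : forall x : D, x != 0 -> x \is a GRing.unit.

Lemma skewsub_unit x : x != 0 -> x \is a GRing.unit.
Proof.
move=> x0; have vU : skewsub_val x \is a GRing.unit.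
  apply: DU; apply: contra_neq x0 => vx; apply: skewsub_val_inj.
  by rewrite vx rmorph0.
apply/unitrP; exists (SkewSubfield (skew_genV (skewsubP x))).
by split; apply: skewsub_val_inj; rewrite rmorphM rmorph1 /= ?mulVr ?mulrV.
Qed.

Lemma skewsub_valV x : skewsub_val x^-1 = (skewsub_val x)^-1.
Proof. by apply: rmorph_divringV; apply: skewsub_unit. Qed.

(** The elements on which f and g agree, seen in D, are closed under
differences and quotients, so they contain whatever S generates. *)
Lemma skewsub_eqmorph (E : unitRingType)
    (f g : {rmorphism skewSubfield S -> E}) :
  (forall x, S (skewsub_val x) -> f x = g x) -> f =1 g.
Proof.
move=> fgS x.
pose P : {pred D} := [pred y | `[< exists2 z, skewsub_val z = y & f z = g z >]].
have PE (y : D) : reflect (exists2 z, skewsub_val z = y & f z = g z) (y \in P).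
  exact: asboolP.
have: skewsub_val x \in P.
  have /skew_genP := skewsubP x; apply.
    split=> [|y z|y z].
    - by apply/PE; exists 1; rewrite !rmorph1.
    - move=> /PE[y' <- fy] /PE[z' <- fz]; apply/PE; exists (y' - z').
        by rewrite rmorphB.
      by rewrite !rmorphB fy fz.
    - move=> /PE[y' <- fy] /PE[z' <- fz]; apply/PE; exists (y' / z').
        by rewrite -skewsub_valV -rmorphM.
      have zU := @skewsub_unit z'.
      by rewrite !rmorphM !rmorph_divringV // fy fz.
  move=> y Sy; apply/PE; exists (SkewSubfield (mem_skew_gen Sy)) => //.
  exact: fgS.
by move=> /PE[z /skewsub_val_inj ->].
Qed.

End SubfieldMorphisms.

(** * The commutation exponents of the geometric torus *)

Section GeomForm.
Variable n : nat.
Hypothesis n_gt2 : (2 < n)%N.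
Implicit Types (i a b : 'Z_n).

Lemma ZnN1_neq1 : -1 != 1 :> 'Z_n.
Proof. by rewrite eq_sym -subr_eq0 opprK; case: n n_gt2 => [|[|[|]]]. Qed.

Lemma Zn_char : n%:R = 0 :> 'Z_n.
Proof. by rewrite pchar_Zp // ltnW. Qed.

(** The exponent of geom_form for two generators of rows j and j' whose classes
differ by d; it makes visible that only the difference matters. *)
Definition class_coef (j j' : nat) (d : 'Z_n) : int :=
  if d == 1 then (if (j <= j')%N then 1 else -1)
  else if d == -1 then (if (j' <= j)%N then -1 else 1)
  else if d == 0 then (if (j < j')%N then -2 else if (j > j')%N then 2 else 0)
  else 0.

Lemma geom_formE j i j' i' :
  geom_form (j, i) (j', i') = class_coef j j' (i + j%:R - (i' + j'%:R)).
Proof.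
rewrite /geom_form /class_coef /geom_class /=.
have -> : (i + j%:R - 1 == i' + j'%:R - 1 + 1) = (i + j%:R - (i' + j'%:R) == 1).
  by rewrite -subr_eq0 -[RHS]subr_eq0; congr (_ == 0); ring.
have -> : (i' + j'%:R - 1 == i + j%:R - 1 + 1) =
          (i + j%:R - (i' + j'%:R) == -1).
  by rewrite -subr_eq0 -[RHS]subr_eq0 -oppr_eq0; congr (_ == 0); ring.
have -> : (i + j%:R - 1 == i' + j'%:R - 1) = (i + j%:R - (i' + j'%:R) == 0).
  by rewrite -subr_eq0; congr (_ == 0); ring.
by [].
Qed.

(** Only d = 1, -1, 0 contribute. The contributions are 1, -1, 0 when the rows
coincide and 1, 1, -2 up to a common sign otherwise. *)
Lemma sum_class_coef j j' : \sum_(d : 'Z_n) class_coef j j' d = 0.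
Proof.
have n1 := ZnN1_neq1.
have n2 : 0 != 1 :> 'Z_n by rewrite eq_sym oner_eq0.
have n3 : 0 != -1 :> 'Z_n by rewrite eq_sym oppr_eq0 oner_eq0.
rewrite (bigD1 1) //= (bigD1 (-1)) //= (bigD1 0) ?n2 ?n3 //= big1; last first.
  move=> d /andP[/andP[/negbTE d1 /negbTE d2] /negbTE d3].
  by rewrite /class_coef d1 d2 d3.
rewrite /class_coef eqxx (negbTE n1) eqxx (negbTE n2) (negbTE n3) eqxx.
by case: ltngtP.
Qed.

Lemma sum_row (f : 'Z_n -> int) (i : 'Z_n) :
  \sum_(1 <= l < n.+1) f (i - l%:R) = \sum_d f d.
Proof.
pose g l := f (i - l.+1%:R).
rewrite big_add1 /= -[LHS]/(\sum_(0 <= l < n) g l).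
rewrite -(congr1 (fun k => \sum_(0 <= l < k) g l) (Zp_cast (ltnW n_gt2))).
rewrite big_mkord /g.
rewrite [RHS](reindex_inj (h := fun d : 'Z_n => i - 1 - d)); last first.
  by move=> d d' /addrI/oppr_inj.
apply: eq_bigr => d _; congr (f _).
by rewrite -addrA -opprD -[in LHS](addn1 d) addnC natrD natr_Zp.
Qed.

(** This is why a full row of generators commutes with everything. *)
Lemma sum_geom_form j i j' i' :
  \sum_(1 <= l < n.+1) geom_form (j, i) (j', i' - l%:R) = 0.
Proof.
rewrite (sum_row (fun b => geom_form (j, i) (j', b))).
rewrite -[RHS](sum_class_coef j j').
rewrite (reindex_inj (h := fun d : 'Z_n => i + j%:R - j'%:R - d)) /=;
  last first.
  by move=> d d' /addrI/oppr_inj.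
by apply: eq_bigr => d _; rewrite geom_formE; congr class_coef; ring.
Qed.

Lemma natr_Zn_neq0 k : (0 < k < n)%N -> k%:R != 0 :> 'Z_n.
Proof.
case/andP=> k_gt0 k_lt; apply/negP => /eqP/(congr1 (@nat_of_ord _)).
by rewrite val_Zp_nat ?(ltnW n_gt2) // modn_small //=; case: k k_gt0 {k_lt}.
Qed.

Lemma geom_formS_0 j i : geom_form (j, i + 1) (j.+1, i) = -2.
Proof.
have n1 : 0 != 1 :> 'Z_n by rewrite eq_sym oner_eq0.
have n2 : 0 != -1 :> 'Z_n by rewrite eq_sym oppr_eq0 oner_eq0.
rewrite geom_formE -[j.+1%:R]natr1 (_ : _ - _ = 0); last by ring.
by rewrite /class_coef (negbTE n1) (negbTE n2) eqxx ltnS leqnn.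
Qed.

Lemma geom_formS_N1 j i : geom_form (j, i) (j.+1, i) = 1.
Proof.
have n1 := ZnN1_neq1.
rewrite geom_formE -[j.+1%:R]natr1 (_ : _ - _ = -1); last by ring.
by rewrite /class_coef (negbTE n1) eqxx ltnn.
Qed.

Lemma geom_form_row1 j i : geom_form (j, i + 1) (j, i) = 1.
Proof.
rewrite geom_formE (_ : _ - _ = 1); last by ring.
by rewrite /class_coef eqxx leqnn.
Qed.

(** q_(j,a) and q_(j+1,a-1) lie in the same class, so a generator of a row k
can tell them apart only through the order of k, j and j+1; no row lies strictly
between j and j+1. *)
Lemma geom_form_ratio k b j a : k != j -> k != j.+1 ->
  geom_form (k, b) (j, a) = geom_form (k, b) (j.+1, a - 1).
Proof.
move=> kj kjS; rewrite !geom_formE -[j.+1%:R]natr1.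
rewrite (_ : a - 1 + _ = a + j%:R); last by ring.
rewrite /class_coef; have -> : (k <= j.+1)%N = (k <= j)%N by lia.
have -> : (j.+1 <= k)%N = (j <= k)%N by lia.
rewrite ltnS; have -> : (k < j)%N = (k <= j)%N by lia.
by have -> : (j.+1 < k)%N = (j <= k)%N by lia.
Qed.

(** Within row j+1 the order of the rows matters for the class differences 0
and 1 only, i.e. for the two columns excluded here. *)
Lemma geom_form_ratioS b j a : b != a -> b != a - 1 ->
  geom_form (j.+1, b) (j, a) = geom_form (j.+1, b) (j.+1, a - 1).
Proof.
move=> ba baB; rewrite !geom_formE -[j.+1%:R]natr1.
rewrite (_ : a - 1 + _ = a + j%:R); last by ring.
rewrite /class_coef; have -> : (b + (j%:R + 1) - (a + j%:R) == 1) = false.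
  apply: contra_neqF ba => /eqP e; apply/eqP.
  by rewrite -subr_eq0 -(subrr 1) -{1}e; apply/eqP; ring.
have -> : (b + (j%:R + 1) - (a + j%:R) == 0) = false.
  apply: contra_neqF baB => /eqP e; apply/eqP.
  by rewrite -subr_eq0 -e; apply/eqP; ring.
by rewrite leqnSn leqnn.
Qed.

End GeomForm.

(** * Commutation up to powers of epsilon *)

(** The computations take place in any skew field D with central elements
eps c that multiply like the powers eps^c. *)
Section EpsCommutation.
Variables (D : unitRingType) (eps : int -> D).
Hypothesis eps0 : eps 0 = 1.
Hypothesis epsD : forall c d, eps (c + d) = eps c * eps d.
Hypothesis epsC : forall c x, GRing.comm x (eps c).

Lemma eps_unit c : eps c \is a GRing.unit.
Proof.
by apply/unitrP; exists (eps (- c)); rewrite -!epsD subrr addNr eps0.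
Qed.

Definition eps_comm (c : int) (x y : D) : Prop := x * y = eps c * (y * x).

Lemma eps_comm0 x y : eps_comm 0 x y <-> GRing.comm x y.
Proof. by rewrite /eps_comm eps0 mul1r. Qed.

Lemma eps_commM c d x y z :
  eps_comm c x y -> eps_comm d x z -> eps_comm (c + d) x (y * z).
Proof.
rewrite /eps_comm epsD => xy xz.
by rewrite mulrA xy -!mulrA xz !mulrA; congr (_ * _ * _); rewrite -!mulrA epsC.
Qed.

Lemma eps_commV c x y :
  y \is a GRing.unit -> eps_comm c x y -> eps_comm (- c) x y^-1.
Proof.
move=> yU xy; apply: (mulIr yU); rewrite mulrVK // -!mulrA xy.
rewrite [_^-1 * _]mulrA epsC -[_ * _ * (y * x)]mulrA mulKr // mulrA.
by rewrite -epsD addNr eps0 mul1r.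
Qed.

Lemma eps_comm_prod (J : Type) (r : seq J) (c : J -> int) x (y : J -> D) :
  (forall l, eps_comm (c l) x (y l)) ->
  eps_comm (\sum_(l <- r) c l) x (\prod_(l <- r) y l).
Proof.
move=> xy; elim: r => [|l r IH].
  by rewrite !big_nil; apply/eps_comm0/commr1.
by rewrite !big_cons; apply: eps_commM.
Qed.

(** * Factorization of kappa *)

(** The family x stands for the generators q_(j,i) of the geometric torus. *)
Section Rows.
Variables (m n : nat) (x : nat -> 'Z_n -> D).
Hypothesis n_gt2 : (2 < n)%N.
Hypothesis DU : forall z : D, z != 0 -> z \is a GRing.unit.
Hypothesis xU : forall j i, x j i \is a GRing.unit.
Hypothesis xx : forall j i j' i', (1 <= j <= m)%N -> (1 <= j' <= m)%N ->
  eps_comm (geom_form (j, i) (j', i')) (x j i) (x j' i').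

Variable j : nat.
Hypothesis hj : (1 <= j <= m)%N.
Hypothesis hjS : (1 <= j.+1 <= m)%N.

Let n_gt0 : (0 < n)%N := ltnW (ltnW n_gt2).

Let p i := x j i.
Let q i := x j.+1 i.

(** For x := geom_q Q this is geom_kappa Q j, by conversion. *)
Definition kappa i : D :=
  \sum_(0 <= h < n) (\prod_(1 <= l < h.+1) p (i - l%:R)) *
                    (\prod_(h.+2 <= l < n.+1) q (i - l%:R)).

Definition ratio i : D := (p i)^-1 * q (i - 1).

Definition ratio_sum i : D :=
  \sum_(0 <= k < n) \prod_(0 <= l < k) ratio (i + l%:R).

Definition row_prod i : D := \prod_(1 <= l < n.+1) p (i - l%:R).

(** Applied to the generators for which geom_form_ratio or geom_form_ratioS
provides the equality of exponents. *)
Lemma ratio_comm k b a : (1 <= k <= m)%N ->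
  geom_form (k, b) (j, a) = geom_form (k, b) (j.+1, a - 1) ->
  GRing.comm (x k b) (ratio a).
Proof.
move=> hk kE; apply/eps_comm0.
rewrite -(addNr (geom_form (k, b) (j, a))) {2}kE.
apply: eps_commM; last exact: xx.
by apply: eps_commV; [apply: xU | apply: xx].
Qed.

Lemma row_prod_comm k b i : (1 <= k <= m)%N -> GRing.comm (x k b) (row_prod i).
Proof.
move=> hk; apply/eps_comm0; rewrite -(sum_geom_form n_gt2 k b j i).
by apply: eps_comm_prod => l; apply: xx.
Qed.

Lemma row_prod_unit i : row_prod i \is a GRing.unit.
Proof. by apply: rpred_prod => l _; apply: xU. Qed.

Lemma row_prod_recr i :
  row_prod i = (\prod_(1 <= l < n) p (i - l%:R)) * p i.
Proof. by rewrite /row_prod big_nat_recr ?n_gt0 //= Zn_char // subr0. Qed.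

(** A rotation of the row by one column is a conjugation by one of its
generators, which commutes with the row. *)
Lemma row_prodS i : row_prod (i + 1) = row_prod i.
Proof.
apply: (mulIr (xU j i)); rewrite -[RHS](row_prod_comm i i hj).
rewrite [row_prod i]row_prod_recr mulrA.
congr (_ * _); rewrite /row_prod big_ltn ?ltnS //; congr (_ * _).
  by rewrite addrK.
by rewrite big_add1 /=; apply: eq_bigr => l _; rewrite -natr1; congr p; ring.
Qed.

(** The terms of kappa are taken from the last one backwards. Passing from k to
k+1 replaces the last p, in column a = i+k+1, by q_(a-1), that is, inserts
u_a = p_a^-1 q_(a-1) just behind it. The products of the q's on the right
commute with u_a, so that u_a can as well be appended at the end. *)
Lemma kappa_term i k : (k < n)%N ->
  (\prod_(1 <= l < (n - k.+1).+1) p (i - l%:R)) *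
  (\prod_((n - k.+1).+2 <= l < n.+1) q (i - l%:R)) =
  row_prod i * (p i)^-1 * \prod_(0 <= l < k) ratio (i + 1 + l%:R).
Proof.
elim: k => [|k IH] kn.
  rewrite subn1 prednK // [X in _ * X]big_geq //.
  by rewrite [in RHS]big_geq // !mulr1 row_prod_recr mulrK // xU.
rewrite [in RHS]big_nat_recr //= mulrA -{}IH ?(ltnW kn) //.
(* h is the index of the term k+1, and h.+1 that of the term k *)
have [h hE] : exists h, n = (h + k.+2)%N by exists (n - k.+2)%N; rewrite subnK.
have -> : (n - k.+2 = h)%N by lia.
have -> : (n - k.+1 = h.+1)%N by lia.
have -> : i + 1 + k%:R = i - h.+1%:R.
  have n0 : (h.+1 + k.+1)%:R = 0 :> 'Z_n.
    by rewrite (_ : _ + _ = n)%N ?Zn_char // hE addSnnS.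
  apply/eqP; rewrite -subr_eq0 -n0 natrD -!natr1.
  by apply/eqP; ring.
rewrite [in RHS]big_nat_recr //= -[in RHS]mulrA -[in RHS]mulrA.
have Yu : GRing.comm (\prod_(h.+3 <= l < n.+1) q (i - l%:R))
                     (ratio (i - h.+1%:R)).
  apply: commr_sym; rewrite big_nat; apply: commr_prod => l /andP[hl ln].
  (* the columns i - l stay clear of i - (h+1) and i - (h+2) modulo n *)
  apply: commr_sym; apply: ratio_comm => //; apply: geom_form_ratioS => //.
    have: (l - h.+1)%:R != 0 :> 'Z_n by apply: natr_Zn_neq0 => //; lia.
    rewrite natrB; last by lia.
    apply: contra_neq => e; rewrite -[RHS](subrr i) -{1}[i](subrK l%:R) e; ring.
  have: (l - h.+2)%:R != 0 :> 'Z_n by apply: natr_Zn_neq0 => //; lia.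
  rewrite natrB; last by lia.
  rewrite -[h.+2%:R]natr1.
  apply: contra_neq => e; rewrite -[RHS](subrr i) -{1}[i](subrK l%:R) e; ring.
rewrite [in RHS]Yu {Yu} /ratio -[in RHS]mulrA mulVKr; last exact: xU.
rewrite [X in _ * X = _]big_ltn; last by lia.
congr (_ * (q _ * _)); rewrite -[h.+2%:R]natr1; ring.
Qed.

Lemma kappaE i : kappa i = row_prod 0 * (p i)^-1 * ratio_sum (i + 1).
Proof.
have -> : row_prod 0 = row_prod i.
  rewrite -[i]natr_Zp; elim: (i : nat) => // k IH.
  by rewrite -natr1 row_prodS.
rewrite /kappa big_nat_rev /= /ratio_sum mulr_sumr; apply: eq_big_nat => k kn.
by rewrite add0n; apply: kappa_term; case/andP: kn.
Qed.

(** The two copies of F cancel, and what remains of the kappas is a monomial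
in p around y and the sums of products of ratios. *)
Lemma kappa_conj i i' y : GRing.comm (row_prod 0) y ->
  (kappa i)^-1 * y * kappa i' =
  (ratio_sum (i + 1))^-1 * (p i * y * (p i')^-1) * ratio_sum (i' + 1).
Proof.
move=> Fy; rewrite !kappaE !divring_invM // invrK -!mulrA.
do 2 congr (_ * _); rewrite [y * _]mulrA -Fy !mulrA.
by rewrite mulVr ?row_prod_unit // mul1r.
Qed.

Lemma kappa_conj_row i :
  (kappa (i + 1))^-1 * ((q i)^-1 * p (i - 1)) * kappa (i - 1) =
  (ratio_sum (i + 2))^-1 * (eps 2 * ((q i)^-1 * p (i + 1))) * ratio_sum i.
Proof.
rewrite kappa_conj; last first.
  by apply: commrM; [apply: commrV|]; apply/commr_sym/row_prod_comm.
rewrite subrK -[i + 1 + 1]addrA; congr (_^-1 * _ * _).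
rewrite mulrA mulrK ?xU // -[2]opprK -(geom_formS_0 j i).
by apply: eps_commV; [apply: xU | apply: xx].
Qed.

Lemma kappa_conj_below i :
  (kappa (i - 1))^-1 * q (i - 1) * kappa i =
  (ratio_sum i)^-1 * ((p i)^-1 * q (i - 1) * p (i - 1)) * ratio_sum (i + 1).
Proof.
rewrite kappa_conj; last exact/commr_sym/row_prod_comm.
rewrite subrK; congr (_ * _ * _).
apply: (mulIr (xU j i)); apply: (mulrI (xU j i)); rewrite divrK; last exact: xU.
rewrite -![in RHS]mulrA mulVKr; last exact: xU.
have: eps_comm (-2 + 1) (p i) (q (i - 1) * p (i - 1)).
  apply: eps_commM.
    by rewrite -(geom_formS_0 j (i - 1)) subrK; apply: xx.
  by rewrite -(geom_form_row1 j (i - 1)) subrK; apply: xx.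
have: eps_comm 1 (p (i - 1)) (q (i - 1)).
  by rewrite -(geom_formS_N1 n_gt2 j (i - 1)); apply: xx.
rewrite /eps_comm => -> E; rewrite mulrA [p i * eps 1]epsC -mulrA E mulrA -epsD.
by rewrite addrC -addrA eps0 mul1r -!mulrA.
Qed.

Lemma kappa_conj_above i :
  (kappa i)^-1 * (p i)^-1 * kappa (i + 1) =
  (ratio_sum (i + 1))^-1 * (p (i + 1))^-1 * ratio_sum (i + 2).
Proof.
rewrite kappa_conj; last by apply/commrV/commr_sym/row_prod_comm.
by rewrite divrr ?xU // mul1r -[i + 1 + 1]addrA.
Qed.

Lemma ratio_sum_comm k b i : (1 <= k <= m)%N -> k != j -> k != j.+1 ->
  GRing.comm (x k b) (ratio_sum i).
Proof.
move=> hk kj kjS; apply: commr_sum => h _; apply: commr_prod => l _.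
by apply: ratio_comm => //; apply: geom_form_ratio.
Qed.

(** * The geometric R-matrix in terms of sums of ratios *)

Let e := eps 1.

(** The image of alpha: the factor eps^k compensates the k factors eps^-1 in
the images of the y's. *)
Lemma scaled_ratio_sum i :
  1 + \sum_(1 <= k < n)
        e ^+ k * \prod_(0 <= l < k) (e^-1 * ratio (i + l%:R)) = ratio_sum i.
Proof.
rewrite /ratio_sum [RHS]big_ltn // [in RHS]big_geq //; congr (_ + _).
apply: eq_bigr => k _; elim: k => [|k IH]; first by rewrite !big_geq // mul1r.
rewrite !big_nat_recr //= -{}IH exprS -!mulrA; set P := \prod_(_ <= _ < _) _.
rewrite [P * (_^-1 * _)]mulrA; have -> : P * e^-1 = e^-1 * P.
  exact: commrV (epsC _ _).
rewrite -[e^-1 * P * _]mulrA [e ^+ k * (_^-1 * _)]mulrA.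
have -> : e ^+ k * e^-1 = e^-1 * e ^+ k.
  by apply: commrV; apply/commr_sym/commrX.
by rewrite -[e^-1 * _ * _]mulrA mulVKr // eps_unit.
Qed.

Lemma kappa_mutation_row i : kappa i \is a GRing.unit ->
  e^-1 * ((kappa i)^-1 * q i * kappa (i + 1))^-1
       * ((kappa i)^-1 * p (i - 1) * kappa (i - 1)) =
  (ratio_sum (i + 2))^-1 * (e^-1 * (p (i + 1))^-1 * q i)^-1 * ratio_sum i.
Proof.
move=> kU; rewrite !divring_invM // !invrK -!mulrA mulVKr //.
have := kappa_conj_row i; rewrite -!mulrA => ->.
set T := (ratio_sum (i + 2))^-1.
have eT : GRing.comm e^-1 T by apply/commr_sym/commrV/epsC.
rewrite [e^-1 * _]mulrA eT -mulrA; congr (_ * _).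
have -> : eps 2 = e * e by rewrite -epsD.
rewrite -[e * e * _]mulrA mulKr ?eps_unit //.
rewrite [p _ * (e * _)]mulrA (epsC 1 _ : GRing.comm _ e) -[e * p _ * _]mulrA.
by rewrite [RHS]mulrA (epsC 1 _ : GRing.comm _ e) -mulrA.
Qed.

Lemma kappa_mutation_below k i : (1 <= k <= m)%N -> k != j -> k != j.+1 ->
  e^-1 * (x k i)^-1 * ((kappa (i - 1))^-1 * q (i - 1) * kappa i) =
  (ratio_sum i)^-1 * e * (e^-1 * (p i)^-1 * q (i - 1))
    * (e^-1 * (x k i)^-1 * p (i - 1)) * ratio_sum (i + 1).
Proof.
move=> hk kj kjS; rewrite kappa_conj_below.
set T := (ratio_sum i)^-1 * ((p i)^-1 * q (i - 1)).
have rT : GRing.comm (x k i)^-1 T.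
  apply/commr_sym/commrV/commr_sym/commrM; first exact/commrV/ratio_sum_comm.
  by apply: ratio_comm => //; apply: geom_form_ratio.
have eT : GRing.comm e^-1 T by apply/commr_sym/commrV/epsC.
set z := p (i - 1) * ratio_sum (i + 1).
transitivity (e^-1 * ((x k i)^-1 * (T * z))); first by rewrite /T /z !mulrA.
transitivity (T * (e^-1 * ((x k i)^-1 * z))); last first.
  by rewrite /T /z -!mulrA mulVKr ?eps_unit.
rewrite [(x k i)^-1 * (T * z)]mulrA rT -[T * (x k i)^-1 * z]mulrA.
by rewrite [e^-1 * (T * _)]mulrA eT -mulrA.
Qed.

Lemma kappa_mutation_above k i b : (1 <= k <= m)%N -> k != j -> k != j.+1 ->
  e^-1 * ((kappa (i + 1))^-1 * p i * kappa i)^-1 * x k b =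
  (ratio_sum (i + 1))^-1 * e * (e^-1 * (p (i + 1))^-1 * q i)
    * (e^-1 * (q i)^-1 * x k b) * ratio_sum (i + 2).
Proof.
move=> hk kj kjS; rewrite !divring_invM // !invrK.
rewrite [_ * ((p i)^-1 * _)]mulrA kappa_conj_above -!mulrA mulVKr ?eps_unit //.
rewrite -(ratio_sum_comm b (i + 2) hk kj kjS).
set T := (ratio_sum (i + 1))^-1 * (p (i + 1))^-1; set z := x k b * _.
have eT : GRing.comm e^-1 T by apply/commr_sym/commrV/epsC.
have eq : GRing.comm e^-1 (q i) by apply/commr_sym/commrV/epsC.
transitivity (e^-1 * (T * z)); first by rewrite /T !mulrA.
transitivity (T * (q i * (e^-1 * ((q i)^-1 * z)))); last by rewrite /T !mulrA.
rewrite [q i * _]mulrA -eq -[e^-1 * q i * _]mulrA mulVKr ?xU //.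
by rewrite mulrA eT -mulrA.
Qed.

Section Morphism.
Variable R : {rmorphism D -> D}.
Hypothesis Re : R e = e.
Hypothesis Rp : forall i, R (p i) = (kappa i)^-1 * q i * kappa (i + 1).
Hypothesis Rq : forall i, R (q i) = (kappa (i + 1))^-1 * p i * kappa i.
Hypothesis Rfix : forall k i, (1 <= k <= m)%N -> k != j -> k != j.+1 ->
  R (x k i) = x k i.

Let RV z : R z^-1 = (R z)^-1.
Proof. by apply: rmorph_divringV; apply: DU. Qed.

(** kappa is invertible because the morphism R exists: were kappa_i zero, so
would be R(p_i), the image of a unit. *)
Lemma kappa_unit i : kappa i \is a GRing.unit.
Proof.
apply: DU; apply: (@unit_mulV_neq0 _ _ (q i) (kappa (i + 1))).
by rewrite -Rp; apply: rmorph_unit; apply: xU.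
Qed.

Lemma mutation_row i :
  R (e^-1 * (p i)^-1 * q (i - 1)) =
  (ratio_sum (i + 2))^-1 * (e^-1 * (p (i + 1))^-1 * q i)^-1 * ratio_sum i.
Proof.
rewrite !rmorphM !RV Re Rp Rq subrK; exact: kappa_mutation_row (kappa_unit i).
Qed.

Lemma mutation_below k i : (1 <= k)%N -> k.+1 = j ->
  R (e^-1 * (x k i)^-1 * x k.+1 (i - 1)) =
  (ratio_sum i)^-1 * e * (e^-1 * (p i)^-1 * q (i - 1))
    * (e^-1 * (x k i)^-1 * x k.+1 (i - 1)) * ratio_sum (i + 1).
Proof.
move=> k_gt0 kj; have hk : (1 <= k <= m)%N by lia.
have kNj : k != j by lia.
have kNjS : k != j.+1 by lia.
rewrite kj !rmorphM !RV Re Rfix // Rp subrK.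
exact: kappa_mutation_below.
Qed.

Lemma mutation_above i : (j.+2 <= m)%N ->
  R (e^-1 * (q i)^-1 * x j.+2 (i - 1)) =
  (ratio_sum (i + 1))^-1 * e * (e^-1 * (p (i + 1))^-1 * q i)
    * (e^-1 * (q i)^-1 * x j.+2 (i - 1)) * ratio_sum (i + 2).
Proof.
move=> jm; rewrite !rmorphM !RV Re Rq Rfix; [|lia|lia|lia].
by apply: kappa_mutation_above; lia.
Qed.

Lemma mutation_fixed k i : (1 <= k)%N -> (k.+1 <= m)%N ->
  k.+1 != j -> k != j -> k != j.+1 ->
  R (e^-1 * (x k i)^-1 * x k.+1 (i - 1)) = e^-1 * (x k i)^-1 * x k.+1 (i - 1).
Proof.
move=> k_gt0 km kSNj kNj kNjS; rewrite !rmorphM !RV Re.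
by rewrite !Rfix //; lia.
Qed.

End Morphism.
End Rows.
End EpsCommutation.

(** * The intertwining identity *)

Section FractionField.
Variables (I : finType) (om : I -> I -> int) (F : skewFracField (qtorus om)).

Definition epsZ (c : int) : F := sff_inj (qtorus_epsZ om c).

Lemma epsZ0 : epsZ 0 = 1.
Proof. by rewrite /epsZ qtorus_epsZ0 rmorph1. Qed.

Lemma epsZD c d : epsZ (c + d) = epsZ c * epsZ d.
Proof. by rewrite /epsZ qtorus_epsZD rmorphM. Qed.

Lemma qtorus_epsZ_central c (g : qtorus om) :
  qtorus_epsZ om c * g = g * qtorus_epsZ om c.
Proof.
rewrite [LHS]qtorus_mulEr [RHS]qtorus_mulEl; apply/eq_bigr => k _.
rewrite !qtorus_mulUU /qmonom_mul /= qcocycle0l qcocycle0r !addr0 add0r.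
by rewrite mulr1 mul1r [c + _]addrC.
Qed.

Lemma epsZ_central c (x : F) : GRing.comm x (epsZ c).
Proof.
have torus_comm (a : qtorus om) : GRing.comm (epsZ c) (sff_inj a).
  by rewrite /GRing.comm /epsZ -!rmorphM qtorus_epsZ_central.
have [a [b [_ ->]]] := sff_frac x.
by apply/commr_sym/commrM; [|apply: commrV]; apply: torus_comm.
Qed.

Lemma sff_injX_unit (a : I) : (sff_inj (qtorusX om a) : F) \is a GRing.unit.
Proof.
have [XV VX] := qtorusXK om a.
apply/unitrP; exists (sff_inj (qtorusXV om a)).
by rewrite -!rmorphM XV VX rmorph1.
Qed.

End FractionField.

Section Intertwining.
Variables (m n : nat) (Q : skewFracField (geom_torus m n)).
Variables (Y : skewFracField (cluster_torus m n)).
Variables (phi : {rmorphism cluster_sub Y -> Q}) (j : nat).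
Hypotheses (n_gt2 : (2 < n)%N) (hphi : is_embedding phi).
Hypothesis hj : (1 <= j <= m.-1)%N.

Lemma geom_q_unit k (i : 'Z_n) : geom_q Q k i \is a GRing.unit.
Proof. exact: sff_injX_unit. Qed.

Lemma embeddingV x : phi x^-1 = (phi x)^-1.
Proof.
by apply: rmorph_divringV; apply: skewsub_unit; apply: sff_unit.
Qed.

(** cluster_alpha as an element of the skew subfield Y', where phi is defined *)
Definition sub_alpha i : cluster_sub Y :=
  1 + \sum_(1 <= k < n) cluster_sub_eps Y ^+ k *
        \prod_(0 <= l < k) cluster_sub_y Y (i + l%:R) hj.

Lemma val_sub_alpha i : skewsub_val (sub_alpha i) = cluster_alpha Y j i.
Proof.
rewrite rmorphD rmorph1 rmorph_sum; congr (_ + _); apply: eq_bigr => k _.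
by rewrite rmorphM rmorphXn rmorph_prod.
Qed.

Lemma phi_alpha i : phi (sub_alpha i) = ratio_sum (geom_q Q) j i.
Proof.
rewrite -[RHS](scaled_ratio_sum (epsZ0 Q) (epsZD Q) (epsZ_central (F := Q))
  _ n_gt2) rmorphD rmorph1 rmorph_sum; congr (_ + _).
apply: eq_bigr => k _.
rewrite rmorphM rmorphXn (embedding_eps hphi) rmorph_prod.
congr (_ * _); apply: eq_bigr => l _.
by rewrite (embedding_y hphi) -mulrA.
Qed.

End Intertwining.

Theorem theorem7p9 (m n : nat) (hn : (3 <= n)%N) (hm : (2 <= m)%N)
    (Q : skewFracField (geom_torus m n))
    (Y : skewFracField (cluster_torus m n))
    (phi : {rmorphism cluster_sub Y -> Q}) (hphi : is_embedding phi)
    (j : nat) (hj : (1 <= j <= m.-1)%N)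
    (R : {rmorphism Q -> Q}) (hR : is_geom_R j R)
    (RM : {rmorphism Y -> Y}) (hRM : is_cluster_R j RM) :
  forall x : cluster_sub Y, R (phi x) = phi (cluster_R_restr hj hRM x).
Proof.
have QU := @sff_unit _ Q; have YU := @sff_unit _ Y.
have hjm : (1 <= j <= m)%N by lia.
have hjSm : (1 <= j.+1 <= m)%N by lia.
have e0 := epsZ0 Q; have eD := epsZD Q; have eC := epsZ_central (F := Q).
have qU := @geom_q_unit m n Q.
have qq k i k' i' : (1 <= k <= m)%N -> (1 <= k' <= m)%N ->
    eps_comm (epsZ Q) (geom_form (k, i) (k', i'))
      (geom_q Q k i) (geom_q Q k' i').
  exact: geom_q_comm.
pose g : {rmorphism cluster_sub Y -> cluster_sub Y} :=
  skewsub_restrict (cluster_R_sub hj hRM).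
pose y_ j' i hj' : cluster_sub Y := @cluster_sub_y m n Y j' i hj'.
have phiy j' i hj' : phi (y_ j' i hj') = _ := embedding_y hphi i hj'.
have val_g x : skewsub_val (g x) = RM (skewsub_val x) by [].
apply: (skewsub_eqmorph YU (f := R \o phi) (g := phi \o g)) => x gen_x.
change (R (phi x) = phi (g x)).
case: gen_x => [xe|[j' [i [hj' xy]]]].
  have {x xe} -> : x = cluster_sub_eps Y by apply: skewsub_val_inj.
  have -> : g (cluster_sub_eps Y) = cluster_sub_eps Y.
    by apply: skewsub_val_inj; rewrite val_g (cluster_R_eps hRM).
  by rewrite (embedding_eps hphi) (geom_R_eps hR).
have {x xy} -> : x = y_ j' i hj' by apply: skewsub_val_inj.
rewrite [in LHS]phiy.
have Re := geom_R_eps hR; have Rp := geom_R_p hR; have Rq := geom_R_q hR.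
have Rfix := geom_R_fix hR.
have val_y k l hk : skewsub_val (y_ k l hk) = cluster_y Y k l by [].
have val_eps : skewsub_val (cluster_sub_eps Y) = cluster_eps Y by [].
have valM := skewsub_valM (S := @cluster_subgens m n Y).
have valV := skewsub_valV YU (S := @cluster_subgens m n Y).
have val_alpha l : skewsub_val (sub_alpha Y hj l) = cluster_alpha Y j l.
  exact: val_sub_alpha.
have valE := (val_g, val_y, val_eps, valM, valV, val_alpha).
have phi_al l : phi (sub_alpha Y hj l) = ratio_sum (geom_q Q) j l.
  exact: phi_alpha.
have phiVx := @embeddingV m n Q Y phi.
have phiE := (rmorphM phi, phiVx, phi_al, phiy, embedding_eps hphi).
have [below|not_below] := eqVneq j'.+1 j.
  have -> : g (y_ j' i hj') = (sub_alpha Y hj i)^-1 * cluster_sub_eps Y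
      * y_ j i hj * y_ j' i hj' * sub_alpha Y hj (i + 1).
    have j'P : j' = j.-1 by lia.
    by apply: skewsub_val_inj; rewrite !valE j'P (cluster_R_yB hRM).
  rewrite !phiE.
  apply: (mutation_below e0 eD eC hn QU qU qq hjm hjSm Re Rp Rfix) => //; lia.
have [same|not_same] := eqVneq j' j.
  have -> : g (y_ j' i hj') = (sub_alpha Y hj (i + 2))^-1 * (y_ j (i + 1) hj)^-1
      * sub_alpha Y hj i.
    by apply: skewsub_val_inj; rewrite !valE same (cluster_R_y hRM).
  rewrite !phiE addrK same.
  exact: (mutation_row e0 eD eC hn QU qU qq hjm hjSm Re Rp Rq).
have [above|not_above] := eqVneq j' j.+1.
  have -> : g (y_ j' i hj') = (sub_alpha Y hj (i + 1))^-1 * cluster_sub_eps Y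
      * y_ j (i + 1) hj * y_ j' i hj' * sub_alpha Y hj (i + 2).
    by apply: skewsub_val_inj; rewrite !valE above (cluster_R_yS hRM).
  rewrite !phiE addrK above.
  apply: (mutation_above e0 eD eC hn QU qU qq hjm hjSm Re Rq Rfix); lia.
have -> : g (y_ j' i hj') = y_ j' i hj'.
  apply: skewsub_val_inj; rewrite val_g val_y.
  by apply: (cluster_R_fix hRM); lia.
rewrite phiy.
apply: (mutation_fixed (eps := epsZ Q) hn QU hjm hjSm Re Rfix) => //; lia.
Qed.
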